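(* Let $X_1,\dots,X_n$ be random variables, let $\bar X=\frac1n\sum_{i=1}^nX_i$, and suppose that $X_i\trianglelefteq_{u_i}0$ for ESI functions $u_1,\dots,u_n$. Then: 1. Under no additional assumptions, $\bar X\trianglelefteq_{nu}0$ with $u=\left(\sum_{i=1}^n\frac1{u_i}\right)^{-1}$. 2. If $X_1,\dots,X_n$ are i.i.d. and $u=u_1=u_2=\dots=u_n$, then $\bar X\trianglelefteq_{nu}0$.
   Context: An ESI function is a continuous, nondecreasing, strictly positive function $u:(0,\infty)\to(0,\infty)$. For an ESI function $u$, $X\trianglelefteq_uY$ means that for all $\epsilon>0$, $\mathbf E[e^{u(\epsilon)(X-Y)}]\le e^{u(\epsilon)\epsilon}$. Operations on ESI functions are pointwise, e.g. $(nu)(\epsilon)=n\cdot u(\epsilon)$. *)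

(* Defs.v *)
(* MathComp-Analysis *)
From HB Require Import structures.
From mathcomp Require Import all_boot all_order all_algebra.
From mathcomp Require Import all_classical all_reals all_analysis.

Set Implicit Arguments.
Unset Strict Implicit.
Unset Printing Implicit Defensive.

Import Order.TTheory GRing.Theory Num.Theory.
Import numFieldNormedType.Exports.

Local Open Scope classical_set_scope.
Local Open Scope ring_scope.

(* A function on (0, oo) is represented by a total function R -> R;
   its values outside (0, oo) are irrelevant. *)
Definition esi_function (R : realType) (u : R -> R) : Prop :=
  [/\ {within [set` `]0, +oo[%R], continuous u},
      {in `]0, +oo[ &, {homo u : x y / x <= y}} &
      {in `]0, +oo[, forall x, 0 < u x}].

(* The expectation is extended-real valued: the exponential moment on the
   left-hand side is not assumed to be finite beforehand. *)
Definition esi (d : measure_display) (T : measurableType d) (R : realType)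
    (P : probability T R) (u : R -> R) (X Y : T -> R) : Prop :=
  forall eps : R, 0 < eps ->
    ('E_P[fun w => expR (u eps * (X w - Y w))%R]
       <= (expR (u eps * eps)%R)%:E)%E.

Definition mutually_independent (d : measure_display) (T : measurableType d)
    (R : realType) (P : probability T R) (n : nat)
    (X : 'I_n -> {RV P >-> R}) : Prop :=
  forall (J : {set 'I_n}) (B : 'I_n -> set R),
    (forall i, i \in J -> measurable (B i)) ->
    (P (\bigcap_(i in [set` J]) (X i @^-1` B i)) =
       \prod_(i in J) P (X i @^-1` B i))%E.

Definition identically_distributed (d : measure_display)
    (T : measurableType d) (R : realType) (P : probability T R) (n : nat)
    (X : 'I_n -> {RV P >-> R}) : Prop :=
  forall (i j : 'I_n) (B : set R), measurable B ->
    distribution P (X i) B = distribution P (X j) B.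

Definition iid (d : measure_display) (T : measurableType d) (R : realType)
    (P : probability T R) (n : nat) (X : 'I_n -> {RV P >-> R}) : Prop :=
  mutually_independent X /\ identically_distributed X.

Definition sample_mean (T : Type) (R : realType) (n : nat)
    (X : 'I_n -> T -> R) (w : T) : R :=
  n%:R^-1 * \sum_(i < n) X i w.

(* Main.v *)
(* Part 1 is Jensen's inequality. With l_i = u / u_i, the weights l_i sum to 1
   and n u (mean X - eps) = sum_i l_i (u_i (X_i - eps)), so that
   exp (n u (mean X - eps)) <= sum_i l_i exp (u_i (X_i - eps)),
   where each term on the right has expectation at most l_i. For part 2,
   exp (n u (mean X)) is the product of the independent variables exp (u X_i),
   and so its expectation is the product of their expectations. *)
Require Import Defs.
From HB Require Import structures.
From mathcomp Require Import all_boot all_order all_algebra.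
From mathcomp Require Import all_classical all_reals all_analysis.
From mathcomp Require Import measurable_realfun.

Set Implicit Arguments.
Unset Strict Implicit.
Unset Printing Implicit Defensive.

Import Order.TTheory GRing.Theory Num.Theory.
Import numFieldNormedType.Exports.

Local Open Scope classical_set_scope.
Local Open Scope ring_scope.

(** * Expectations of products of independent variables *)

Section expectation_of_product.
Context d (T : measurableType d) (R : realType) (P : probability T R).

Import HBNNSimple.

(** The hypothesis on indicators says that [W] has conditional expectation [c] given [X]. It extends
    by linearity to simple functions and by monotone convergence to every nonnegative measurable
    [f]. *)
Lemma ge0_integral_density_comp d' (Y : measurableType d') (X : T -> Y)
    (W : T -> R) (c : \bar R) :
    measurable_fun setT X -> measurable_fun setT W -> (forall w, 0 <= W w) ->
    (0 <= c)%E -> c \is a fin_num ->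
    (forall B, measurable B ->
      \int[P]_w (\1_B (X w) * W w)%:E = c * \int[P]_w (\1_B (X w))%:E)%E ->
  forall f : Y -> R, measurable_fun setT f -> (forall x, 0 <= f x) ->
    (\int[P]_w (f (X w) * W w)%:E = c * \int[P]_w (f (X w))%:E)%E.
Proof.
move=> mX mW W0 c0 cfin cE f mf f0.
have mEf : measurable_fun setT (EFin \o f) by exact/measurable_EFinP.
pose h := nnsfun_approx measurableT mEf.
have mhX k : measurable_fun setT (fun w => h k (X w)).
  exact: measurableT_comp.
have hnd x m k : (m <= k)%N -> h m x <= h k x.
  by move=> mk; exact/lefP/nd_nnsfun_approx.
have hcvg x : (EFin \o h^~ x) @ \oo --> (f x)%:E.
  by apply: (cvg_nnsfun_approx measurableT mEf) => // y _; rewrite lee_fin.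
(* Both sides are split over the values [y] of [h k]; the indicator hypothesis is then used with the
   level set of [h k] at [y]. *)
have hE k : (\int[P]_w (h k (X w) * W w)%:E = c * \int[P]_w (h k (X w))%:E)%E.
  have mI y : measurable_fun setT (fun w => \1_(h k @^-1` [set y]) (X w) : R).
    by apply: measurableT_comp => //; exact: measurable_indic.
  under eq_integral => w _.
    rewrite fimfunE EFinM -fsumEFin// ge0_mule_fsuml; last first.
      by move=> y; exact: nnfun_muleindic_ge0.
    over.
  rewrite ge0_integral_fsum//; last 2 first.
  - move=> y; apply/measurable_EFinP; apply: measurable_funM => //.
    exact: measurable_funM.
  - by move=> y w _; rewrite mule_ge0 ?lee_fin//; exact: nnfun_muleindic_ge0.
  under [in RHS]eq_integral do rewrite fimfunE -fsumEFin//.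
  rewrite ge0_integral_fsum//; last 2 first.
  - by move=> y; apply/measurable_EFinP; exact: measurable_funM.
  - by move=> y w _; exact: nnfun_muleindic_ge0.
  rewrite ge0_mule_fsumr; last first.
    by move=> y; apply: integral_ge0 => w _; exact: nnfun_muleindic_ge0.
  apply: eq_fsbigr => y; rewrite inE => -[x _ hx].
  have y0 : 0 <= y by rewrite -hx.
  under eq_integral do rewrite -EFinM -mulrA EFinM.
  under [in RHS]eq_integral do rewrite EFinM.
  rewrite !ge0_integralZl_EFin//; first by rewrite cE// muleCA.
  - exact/measurable_EFinP.
  - by move=> w _; rewrite lee_fin mulr_ge0.
  - by apply/measurable_EFinP; exact: measurable_funM.
have cv1 : ((fun k => \int[P]_w (h k (X w) * W w)%:E) @ \oo -->
            \int[P]_w (f (X w) * W w)%:E)%E.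
  rewrite (_ : \int[P]_w (f (X w) * W w)%:E =
     \int[P]_w limn (fun k => (h k (X w) * W w)%:E))%E; last first.
    apply: eq_integral => w _; apply/esym/cvg_lim => //.
    under eq_fun do rewrite EFinM.
    by rewrite EFinM; apply: cvgeZr => //; exact: hcvg.
  apply: cvg_monotone_convergence => //.
  - by move=> k; apply/measurable_EFinP; exact: measurable_funM.
  - by move=> k w _; rewrite lee_fin mulr_ge0.
  - by move=> w _ m k mk; rewrite lee_fin ler_wpM2r// hnd.
(* Finiteness of [c] lets multiplication by [c] pass to the limit in the extended reals. *)
have cv2 : ((fun k => c * \int[P]_w (h k (X w))%:E) @ \oo -->
            c * \int[P]_w (f (X w))%:E)%E.
  apply: cvgeZl => //.
  rewrite (_ : \int[P]_w (f (X w))%:E =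
     \int[P]_w limn (fun k => (h k (X w))%:E))%E; last first.
    by apply: eq_integral => w _; apply/esym/cvg_lim => //; exact: hcvg.
  apply: cvg_monotone_convergence => //.
  - by move=> k; exact/measurable_EFinP.
  - by move=> k w _; rewrite lee_fin.
  - by move=> w _ m k mk; rewrite lee_fin hnd.
move: cv1; under eq_fun do rewrite hE.
move=> cv1; exact: (cvg_unique _ cv1 cv2).
Qed.

(* The factors are freed one at a time: with the first [k] of them arbitrary
   and the others indicators, [k = 0] is the definition of independence, and
   going from [k] to [k.+1] is [ge0_integral_density_comp]. *)
Lemma mutually_independent_integral_prod n (X : 'I_n -> {RV P >-> R})
    (f : 'I_n -> R -> R) :
    mutually_independent X ->
    (forall i, measurable_fun setT (f i)) -> (forall i x, 0 <= f i x) ->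
    (forall i, (\int[P]_w (f i (X i w))%:E < +oo)%E) ->
  (\int[P]_w (\prod_(i < n) f i (X i w))%:E =
   \prod_(i < n) \int[P]_w (f i (X i w))%:E)%E.
Proof.
move=> indep mf f0 foo.
pose g k (B : 'I_n -> set R) (i : 'I_n) : R -> R :=
  if (i < k)%N then f i else \1_(B i).
suff main k B : (k <= n)%N -> (forall i, measurable (B i)) ->
    (\int[P]_w (\prod_(i < n) g k B i (X i w))%:E =
     \prod_(i < n) \int[P]_w (g k B i (X i w))%:E)%E.
  have := main n (fun=> setT) (leqnn n) (fun=> measurableT).
  rewrite (_ : g n _ = f)//.
  by apply/funext => i; rewrite /g ltn_ord.
elim: k B => [|k IH] B kn mB.
  have gE i x : g 0%N B i x = \1_(B i) x by [].
  have mXB i : measurable (X i @^-1` B i).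
    by rewrite -[_ @^-1` _]setTI; exact: measurable_funPT.
  (* The product of the indicators is the indicator of the intersection, so independence is needed
     for the full index set. *)
  transitivity (P (\bigcap_(i in [set` [set: 'I_n]%SET]) (X i @^-1` B i))).
    rewrite -[X in P X]setIT -integral_indic//; last first.
      by apply: fin_bigcap_measurable.
    apply: eq_integral => w _; congr EFin.
    rewrite indicE; case: (boolP (w \in _)) => [|/negP wB].
      rewrite inE => wB; apply: big1 => i _.
      by rewrite gE indicE mem_set//; apply: wB => /=; rewrite finset.in_setT.
    have [i wi] : exists i, ~ B i (X i w).
      apply/existsNP => wB'; apply: wB; rewrite inE => i _; exact: wB'.
    by rewrite (bigD1 i)//= gE indicE memNset// mul0r.
  rewrite indep//; apply: eq_big => [i|i _]; first by rewrite finset.in_setT.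
  by rewrite -[X in P X]setIT -integral_indic.
(* The factor of index [k] is the only one that changes between stages [k] and [k.+1]. *)
pose i0 : 'I_n := Ordinal kn.
have g_i0 : g k.+1 B i0 = f i0 by rewrite /g /= ltnSn.
have mg j C i : (forall i, measurable (C i)) -> measurable_fun setT (g j C i).
  by move=> mC; rewrite /g; case: ifP => // _; exact: measurable_indic.
have g0 j C i x : 0 <= g j C i x by rewrite /g; case: ifP.
have ig0 j C i : (0 <= \int[P]_w (g j C i (X i w))%:E)%E.
  by apply: integral_ge0 => w _; rewrite lee_fin.
have igfin j C i : (forall i, measurable (C i)) ->
    (\int[P]_w (g j C i (X i w))%:E)%E \is a fin_num.
  move=> mC; rewrite ge0_fin_numE// /g; case: ifP => // _.
  have mXC : measurable (X i @^-1` C i).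
    by rewrite -[_ @^-1` _]setTI; exact: measurable_funPT.
  rewrite [ltLHS](_ : _ = P (X i @^-1` C i)).
    by rewrite (le_lt_trans (probability_le1 _ _))// ltry.
  by rewrite -[X in P X]setIT -integral_indic.
rewrite [RHS](bigD1 i0)//= muleC.
under eq_integral do rewrite (bigD1 i0)//=.
(* Here [W] is the product of the factors other than [i0], and [c] is the product of their
   expectations, finite because each of them is. *)
rewrite g_i0; apply: ge0_integral_density_comp => //.
- under eq_fun do rewrite -big_filter.
  apply: measurable_prod => i _.
  by apply: measurableT_comp => //; exact: mg.
- by move=> w; apply: prodr_ge0.
- by apply: prode_ge0.
- by apply: prode_fin_num => i _; exact: igfin.
move=> C mC.
(* Against the indicator of [C], the identity is the induction hypothesis for the family [B] with
   its entry at [i0] replaced by [C]. *)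
pose B' i := if i == i0 then C else B i.
have mB' i : measurable (B' i) by rewrite /B'; case: ifP.
have := IH B' (ltnW kn) mB'.
have g'_i0 : g k B' i0 = \1_C by rewrite /g ltnn /B' eqxx.
have g'E i : i != i0 -> g k B' i = g k.+1 B i.
  move=> ii0; rewrite /g /B' (negPf ii0) [in RHS]ltnS [in RHS]leq_eqVlt.
  by rewrite -[(_ == k)%N]/(i == i0) (negPf ii0).
rewrite [RHS](bigD1 i0)//= muleC g'_i0.
under eq_bigr => i /g'E -> do [].
move=> <-; apply: eq_integral => w _.
rewrite [in RHS](bigD1 i0)//= g'_i0; congr (_ * _)%:E.
by apply: eq_bigr => i /g'E ->.
Qed.

End expectation_of_product.

(** * Stability properties of ESI functions, and Jensen's inequality for [expR] *)

Section esi_functions.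
Context (R : realType).
Implicit Types u : R -> R.

(** The half-line is open, so continuity on it as a subspace is ordinary continuity at each of its
    points. *)
Lemma esi_functionP u : esi_function u <->
  [/\ forall x, 0 < x -> {for x, continuous u},
      forall x y, 0 < x -> x <= y -> u x <= u y &
      forall x, 0 < x -> 0 < u x].
Proof.
have posE (x : R) : (x \in `]0, +oo[) = (0 < x) by rewrite in_itv/= andbT.
have oI : open [set` `]0, +oo[%R : interval R] by exact: interval_open.
split=> -[cu hu pu]; split.
- move=> x x0; have := cu; rewrite continuous_open_subspace// => /(_ x).
  by rewrite inE/= posE; exact.
- by move=> x y x0 xy; apply: hu; rewrite ?posE// (lt_le_trans x0).
- by move=> x x0; apply: pu; rewrite posE.
- by rewrite continuous_open_subspace// => x; rewrite inE/= posE; exact: cu.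
- by move=> x y; rewrite !posE => x0 _; exact: hu.
- by move=> x; rewrite posE; exact: pu.
Qed.

(** Continuity transfers because two functions that agree on the half-line agree near each of its
    points. This serves part 2, where the common [u] is prescribed only there. *)
Lemma eq_esi_function u v : {in `]0, +oo[, u =1 v} ->
  esi_function u -> esi_function v.
Proof.
move=> uv /esi_functionP[cu hu pu].
have {}uv x : 0 < x -> u x = v x by move=> x0; rewrite uv// in_itv/= x0.
apply/esi_functionP; split.
- move=> x x0; change (v y @[y --> x] --> v x); rewrite -uv//.
  apply: cvg_trans (cu x x0); apply: near_eq_cvg.
  by near=> y; apply: uv; near: y; exact: lt_nbhsr.
- by move=> x y x0 xy; rewrite -!uv ?hu// (lt_le_trans x0).
- by move=> x x0; rewrite -uv// pu.
Unshelve. all: by end_near. Qed.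

Lemma esi_functionZ (c : R) u : 0 < c ->
  esi_function u -> esi_function (fun eps => c * u eps).
Proof.
move=> c0 /esi_functionP[cu hu pu]; apply/esi_functionP; split.
- by move=> x x0; apply: cvgM; [exact: cvg_cst|exact: cu].
- by move=> x y x0 xy; rewrite ler_pM2l//; exact: hu.
- by move=> x x0; rewrite mulr_gt0// pu.
Qed.

Lemma sumV_gt0 n (v : 'I_n -> R) : (0 < n)%N -> (forall i, 0 < v i) ->
  0 < \sum_(i < n) (v i)^-1.
Proof.
case: n v => // n v _ v0; rewrite big_ord_recl ltr_pwDl ?invr_gt0//.
by apply: sumr_ge0 => i _; rewrite invr_ge0 ltW.
Qed.

(** Inversion reverses monotonicity twice. An empty sum would be 0, with inverse 0 by convention,
    which is not positive; hence [0 < n]. *)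
Lemma esi_function_harmonic n (u_ : 'I_n -> R -> R) : (0 < n)%N ->
  (forall i, esi_function (u_ i)) ->
  esi_function (fun eps => (\sum_(i < n) (u_ i eps)^-1)^-1).
Proof.
move=> n0 uE; have {}uE i := (esi_functionP _).1 (uE i).
have u0 i x : 0 < x -> 0 < u_ i x by case: (uE i) => _ _; exact.
have s0 x : 0 < x -> 0 < \sum_(i < n) (u_ i x)^-1.
  by move=> x0; apply: sumV_gt0 => // i; exact: u0.
apply/esi_functionP; split.
- move=> x x0; apply: cvgV; first by rewrite gt_eqF ?s0.
  apply: cvg_big => [|i _]; first exact: add_continuous.
  apply: cvgV; first by rewrite gt_eqF ?u0.
  by case: (uE i) => + _ _; exact.
- move=> x y x0 xy; have y0 := lt_le_trans x0 xy.
  rewrite lef_pV2 ?posrE ?s0//; apply: ler_sum => i _.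
  by rewrite lef_pV2 ?posrE ?u0//; case: (uE i) => _ + _; exact.
- by move=> x x0; rewrite invr_gt0 s0.
Qed.

Lemma expR_convex_sum n (l x : 'I_n -> R) : (forall i, 0 <= l i) ->
  \sum_(i < n) l i = 1 ->
  expR (\sum_(i < n) l i * x i) <= \sum_(i < n) l i * expR (x i).
Proof.
move=> l0 l1; set m := \sum_(i < n) l i * x i.
(* sum the tangent-line bounds of [expR] at the barycenter [m] *)
have -> : expR m = \sum_(i < n) l i * (expR m * (1 + (x i - m))).
  under eq_bigr do rewrite mulrCA mulrDr mulr1 mulrBr.
  by rewrite -mulr_sumr big_split/= sumrB -mulr_suml l1 mul1r subrr addr0 mulr1.
apply: ler_sum => i _; rewrite ler_wpM2l//.
rewrite -[leRHS](_ : expR m * expR (x i - m) = _).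
  by rewrite ler_pM2l ?expR_gt0// expR_ge1Dx.
by rewrite -expRD addrC subrK.
Qed.

End esi_functions.

(** * The two bounds for the sample mean *)

Section esi_sample_mean.
Context d (T : measurableType d) (R : realType) (P : probability T R).
Context (n : nat) (X : 'I_n -> {RV P >-> R}).

Lemma scaled_sample_meanE (v : R) w : (0 < n)%N ->
  n%:R * v * sample_mean X w = \sum_(i < n) v * X i w.
Proof.
move=> n0; rewrite /sample_mean mulrACA divff ?pnatr_eq0 -?lt0n// mul1r.
by rewrite mulr_sumr.
Qed.

Lemma esi_sample_mean_harmonic (u_ : 'I_n -> R -> R) : (0 < n)%N ->
  (forall i, esi_function (u_ i)) -> (forall i, esi P (u_ i) (X i) (cst 0)) ->
  esi P (fun eps => n%:R * (\sum_(i < n) (u_ i eps)^-1)^-1)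
    (sample_mean X) (cst 0).
Proof.
move=> n0 uE XE eps eps0.
have u0 i : 0 < u_ i eps by case/esi_functionP: (uE i) => _ _; exact.
have s0 : 0 < \sum_(i < n) (u_ i eps)^-1 by exact: sumV_gt0.
set s := \sum_(i < n) _ in s0 *.
(* These are the Jensen weights: [s^-1] is the harmonic combination at [eps]. *)
pose l i := s^-1 * (u_ i eps)^-1.
have l0 i : 0 <= l i by rewrite mulr_ge0// invr_ge0 ltW.
have l1 : \sum_(i < n) l i = 1 by rewrite -mulr_sumr mulVf// gt_eqF.
have lu i x : l i * (u_ i eps * x) = s^-1 * x.
  by rewrite mulrA mulfVK// gt_eqF.
(* The shift by [eps] absorbs the right-hand side of the ESI bound, so that each [Z i] has
   expectation at most 1, whatever [u_ i eps] is. *)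
pose Z i w := expR (u_ i eps * (X i w - eps)).
have mZ i : measurable_fun setT (Z i).
  apply: measurableT_comp => //; apply: measurable_funM => //.
  exact: measurable_funB.
have Z1 i : (\int[P]_w (Z i w)%:E <= 1)%E.
  have := XE i eps eps0; rewrite unlock/= => XEi.
  under eq_integral do rewrite /Z mulrBr addrC expRD expRN EFinM.
  rewrite ge0_integralZl_EFin ?invr_ge0 ?expR_ge0//; last first.
  - apply/measurable_EFinP/measurableT_comp => //; exact: measurable_funM.
  rewrite -[leRHS](_ : (expR (u_ i eps * eps))^-1%:E *
    (expR (u_ i eps * eps))%:E = _)%E; last first.
    by rewrite -EFinM mulVf// gt_eqF ?expR_gt0.
  apply: lee_wpmul2l; first by rewrite lee_fin invr_ge0 expR_ge0.
  by under eq_integral do rewrite -[X i _]subr0.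
rewrite unlock/=; set e := expR (n%:R * s^-1 * eps).
(* Pointwise Jensen; the factor [e] undoes the shifts, which add up to [n%:R * s^-1 * eps] in the
   exponent. *)
have key w : expR (n%:R * s^-1 * (sample_mean X w - 0)) <=
    e * \sum_(i < n) l i * Z i w.
  rewrite subr0 scaled_sample_meanE//.
  rewrite -[leLHS](_ : e * expR (\sum_(i < n)
    l i * (u_ i eps * (X i w - eps))) = _).
    by rewrite ler_pM2l ?expR_gt0//; exact: expR_convex_sum.
  rewrite -expRD; congr expR.
  under eq_bigr do rewrite lu mulrBr.
  rewrite sumrB sumr_const card_ord -[s^-1 * eps *+ n]mulr_natl mulrA.
  by rewrite addrC subrK.
apply: (@le_trans _ _ (\int[P]_w (e * \sum_(i < n) l i * Z i w)%:E)%E).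
  apply: ge0_le_integral => //.
  - apply/measurable_EFinP/measurableT_comp => //; apply: measurable_funM => //.
    apply: measurable_funB => //; apply: measurable_funM => //.
    by apply: measurable_sum.
  - apply/measurable_EFinP; apply: measurable_funM => //.
    by apply: measurable_sum => i; exact: measurable_funM.
  - by move=> w _; rewrite lee_fin key.
have lZ0 i w : (0 <= (l i * Z i w)%:E)%E.
  by rewrite lee_fin mulr_ge0 ?expR_ge0.
have mlZ i : measurable_fun setT (fun w => (l i * Z i w)%:E).
  by apply/measurable_EFinP; exact: measurable_funM.
under eq_integral do rewrite EFinM -sumEFin.
rewrite ge0_integralZl_EFin ?expR_ge0//; last 2 first.
- by move=> w _; apply: sume_ge0.
- by apply: emeasurable_sum.
rewrite ge0_integral_sum//.
rewrite -[leRHS]mule1; apply: lee_wpmul2l; first by rewrite lee_fin expR_ge0.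
(* Writing 1 as the sum of the weights reduces the bound to one term at a time. *)
rewrite -[leRHS]/(1%:E) -l1 -sumEFin; apply: lee_sum => i _.
under eq_integral do rewrite EFinM.
rewrite ge0_integralZl_EFin//; last 2 first.
- by move=> w _; rewrite lee_fin expR_ge0.
- exact/measurable_EFinP.
by rewrite -[leRHS]mule1; apply: lee_wpmul2l; rewrite ?lee_fin.
Qed.

Lemma esi_sample_mean_independent (u : R -> R) : (0 < n)%N ->
  mutually_independent X -> (forall i, esi P u (X i) (cst 0)) ->
  esi P (fun eps => n%:R * u eps) (sample_mean X) (cst 0).
Proof.
move=> n0 indep XE eps eps0; rewrite unlock/=.
have XEi i : (\int[P]_w (expR (u eps * X i w))%:E <= (expR (u eps * eps))%:E)%E.
  have := XE i eps eps0; rewrite unlock/=.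
  by under eq_integral do rewrite subr0.
under eq_integral do rewrite subr0 scaled_sample_meanE// expR_sum.
rewrite (mutually_independent_integral_prod
  (f := fun _ x => expR (u eps * x)))//.
- rewrite -mulrA.
  have -> : (expR (n%:R * (u eps * eps)))%:E =
      (\prod_(i < n) (expR (u eps * eps))%:E)%E.
    by rewrite prodEFin prodr_const card_ord expRM_natl.
  (* Inequalities multiply only between nonnegative factors, so nonnegativity is carried along in
     the induction over the product. *)
  suff [] : (0 <= \prod_(i < n) \int[P]_w (expR (u eps * X i w))%:E /\
      \prod_(i < n) \int[P]_w (expR (u eps * X i w))%:E <=
      \prod_(i < n) (expR (u eps * eps))%:E)%E by [].
  apply: (big_ind2 (fun x y => 0 <= x /\ x <= y)%E) => //.
  + move=> x1 x2 y1 y2 [x0 x12] [y0 y12].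
    by split; [exact: mule_ge0|exact: lee_pmul].
  + move=> i _; split=> //.
    by apply: integral_ge0 => w _; rewrite lee_fin expR_ge0.
- by move=> _; apply: measurableT_comp => //; exact: measurable_funM.
(* The ESI bound itself supplies the finite exponential moments that the product formula
   requires. *)
- by move=> i; exact: le_lt_trans (XEi i) (ltry _).
Qed.

End esi_sample_mean.

Theorem corollary8 (d : measure_display) (T : measurableType d)
    (R : realType) (P : probability T R) (n : nat) (n_gt0 : (0 < n)%N)
    (X : 'I_n -> {RV P >-> R}) (u_ : 'I_n -> R -> R)
    (u_esi : forall i, esi_function (u_ i))
    (X_esi : forall i, esi P (u_ i) (X i) (cst 0)) :
  (let u := fun eps : R => (\sum_(i < n) (u_ i eps)^-1)^-1 in
   let nu := fun eps : R => n%:R * u eps in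
   esi_function nu /\ esi P nu (sample_mean X) (cst 0))
  /\
  (forall u : R -> R,
     iid X ->
     (forall i, {in `]0, +oo[, u_ i =1 u}) ->
     let nu := fun eps : R => n%:R * u eps in
     esi_function nu /\ esi P nu (sample_mean X) (cst 0)).
Proof.
split=> [u nu|u [indep _] u_u nu].
  split; last exact: esi_sample_mean_harmonic.
  by apply: esi_functionZ; [rewrite ltr0n|exact: esi_function_harmonic].
(* Since [n] is positive there is an index 0, and [u] inherits the ESI property from [u_] at that
   index. *)
have uE := eq_esi_function (u_u (Ordinal n_gt0)) (u_esi _).
split; first by apply: esi_functionZ; rewrite ?ltr0n.
apply: esi_sample_mean_independent => // i eps eps0.
by rewrite -(u_u i) ?in_itv/= ?eps0//; exact: X_esi.
Qed.
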